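(* For all integers $m,n\geq 3$, the torus graph $T_{m,n}$ satisfies $\beta_M(T_{m,n})=4$.
   Context: The torus graph $T_{m,n}$ is the Cartesian product $C_m\Box C_n$ of cycles: its vertices are pairs $(i,j)$ with $i\in\{0,\dots,m-1\}$, $j\in\{0,\dots,n-1\}$, and $(i,j)$ is adjacent to $(i\pm1 \bmod m, j)$ and $(i, j\pm1 \bmod n)$. For vertices $u,v$, $d(u,v)$ is the number of edges on a shortest $u$–$v$ path. For a vertex $w$ and an edge $e=uv$, $d(w,e)=\min(d(w,u),d(w,v))$. A vertex $w$ resolves two elements $x,y\in V\cup E$ if $d(w,x)\neq d(w,y)$. A set $S\subseteq V$ is a mixed resolving set if every pair of distinct elements of $V\cup E$ is resolved by some element of $S$. The mixed metric dimension $\beta_M(G)$ is the minimum cardinality of a mixed resolving set of $G$. *)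

(* Defs.v *)
From mathcomp Require Import all_boot.
Set Implicit Arguments. Unset Strict Implicit. Unset Printing Implicit Defensive.

(* A finite graph on the vertex type T is given by its adjacency relation
   e : rel T, meant to be symmetric and irreflexive. *)
Section MixedDimension.

Variables (T : finType) (e : rel T).

Definition has_walk (k : nat) (u v : T) : bool :=
  [exists p : k.-tuple T, path e u p && (last u p == v)].

(* A shortest path has fewer than #|T| edges, so the search range is wide
   enough; the value is #|T| when v is not reachable from u. *)
Definition gdist (u v : T) : nat :=
  find (fun k => has_walk k u v) (iota 0 #|T|).

Definition edge_set : {set {set T}} :=
  [set [set uv.1; uv.2] | uv : T * T & e uv.1 uv.2].

Definition edge : finType := {A : {set T} | A \in edge_set}.

(* As gdist never exceeds #|T|, this is min (d(w, u)) (d(w, v)) on the edge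
   [set u; v]. *)
Definition gdist_edge (w : T) (A : edge) : nat :=
  \big[minn/#|T|]_(u in val A) gdist w u.

(* The disjoint union of the vertices and the edges. *)
Definition element : finType := (T + edge)%type.

Definition gdist_element (w : T) (x : element) : nat :=
  match x with
  | inl v => gdist w v
  | inr A => gdist_edge w A
  end.

Definition resolves (w : T) (x y : element) : bool :=
  gdist_element w x != gdist_element w y.

Definition mixed_resolving (S : {set T}) : bool :=
  [forall x : element, forall y : element,
    (x != y) ==> [exists w in S, resolves w x y]].

(* The full vertex set is mixed resolving: of two distinct elements, one
   contains a vertex w that the other does not, and w is at distance 0 from
   exactly one of them. Hence the minimum is over a nonempty family. *)
Definition mixed_metric_dim : nat :=
  #|[arg min_(S < [set: T] | mixed_resolving S) #|S|]|.

End MixedDimension.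

Definition cycle_graph (m : nat) : rel 'I_m :=
  fun i j => (j == i + 1 %[mod m]) || (i == j + 1 %[mod m]).

Definition cartesian_product (T1 T2 : eqType) (e1 : rel T1) (e2 : rel T2) :
    rel (T1 * T2) :=
  fun x y => (e1 x.1 y.1 && (x.2 == y.2)) || ((x.1 == y.1) && e2 x.2 y.2).

Definition torus_graph (m n : nat) : rel ('I_m * 'I_n) :=
  cartesian_product (@cycle_graph m) (@cycle_graph n).

(* Main.v *)
(* Lower bound: let v lie in a mixed resolving set S. A vertex w sees the edge
   from v to a neighbour u at distance d(w, v) - [d(w, u) < d(w, v)], and v
   itself resolves no two elements containing v. Hence v and its deg v incident
   edges are told apart by the sets of those w in S - v that are closer to u than
   to v, and deg v + 1 <= 2 ^ (|S| - 1).

   Upper bound: with p = m / 2 and q = n / 2 rounded down, the vertices (0, 0),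
   (p, 0), (p + 1, 1) and (p + 1, q + 1) resolve. The difference of the distances
   to the first two depends only on the first coordinate of an element, and
   determines it up to a reflection of the cycle; the last two do the same for
   the second coordinate. The distances to (0, 0) and (p + 1, 1) then exclude
   the nontrivial reflections. *)
Require Import Defs.
From mathcomp Require Import all_boot all_order zify.
Set Implicit Arguments. Unset Strict Implicit. Unset Printing Implicit Defensive.

(** * Distances and mixed resolving sets in an arbitrary graph *)

Section Distance.
Variables (T : finType) (e : rel T).
Implicit Types (u v w : T) (S : {set T}).

Lemma has_walkP k u v :
  reflect (exists p, [/\ path e u p, last u p = v & size p = k])
          (has_walk e k u v).
Proof.
apply: (iffP existsP) => [[p /andP[ep /eqP lp]]|[p [ep lp sp]]].
  by exists p; rewrite size_tuple.
by move/eqP: sp => sp; exists (Tuple sp); rewrite ep /= lp.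
Qed.

Lemma gdist_leq_card u v : gdist e u v <= #|T|.
Proof. by rewrite -[leqRHS](size_iota 0) find_size. Qed.

Lemma gdist_leq_path u p : path e u p -> gdist e u (last u p) <= size p.
Proof.
move=> ep; case: (leqP #|T| (size p)) => [|lt_p].
  exact/leq_trans/gdist_leq_card.
rewrite leqNgt; apply/negP => /(before_find 0).
by rewrite nth_iota // add0n => /has_walkP[]; exists p.
Qed.

Lemma gdist_path u v : gdist e u v < #|T| ->
  exists p, [/\ path e u p, last u p = v & size p = gdist e u v].
Proof.
move=> lt_d; apply/has_walkP; have := lt_d.
rewrite -[ltnRHS](size_iota 0) -has_find => /(nth_find 0).
by rewrite nth_iota.
Qed.

Lemma gdistxx u : gdist e u u = 0.
Proof. by apply/eqP; rewrite -leqn0; apply: (@gdist_leq_path u [::]). Qed.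

Lemma gdist_adj w u v : e u v -> gdist e w v <= (gdist e w u).+1.
Proof.
(* If no path reaches [u] from [w], the left vertex gets the default [#|T|], which no value
   exceeds. *)
move=> euv; have := gdist_leq_card w u; rewrite leq_eqVlt => /predU1P[->|].
  exact/leqW/gdist_leq_card.
case/gdist_path => p [ep lp <-]; rewrite -(size_rcons p v).
by rewrite -{1}(last_rcons w p v) gdist_leq_path // rcons_path ep lp.
Qed.

(** Since [f] drops by at most 1 along an edge, it is bounded by the length of any walk; following
    edges along which it does drop gives a walk of length [f u v]. The last hypothesis puts this
    length in the range searched by [gdist]. *)
Lemma gdistE (f : T -> T -> nat) u v :
    (forall x y, f x y = 0 -> x = y) -> (forall x, f x x = 0) ->
    (forall x y z, e x y -> f x z <= (f y z).+1) ->
    (forall x z, 0 < f x z -> exists2 y, e x y & f x z = (f y z).+1) ->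
  f u v < #|T| -> gdist e u v = f u v.
Proof.
move=> f0 fxx fle fdec lt_f.
have f_path p x : path e x p -> f x (last x p) <= size p.
  elim: p x => [|y p IHp] x /=; first by rewrite fxx.
  by case/andP=> exy /IHp le_p; apply: leq_trans (fle _ _ _ exy) _.
have [p [ep lp sp]] : exists p, [/\ path e u p, last u p = v & size p = f u v].
  move: {lt_f}(f u v) {-2}u (erefl (f u v)) => k.
  elim: k => [|k IHk] x fx; first by exists [::]; rewrite fx (f0 _ _ fx).
  have [|y exy fy] := fdec x v; first by rewrite fx.
  have [|p [ep lp sp]] := IHk y; first by apply/succn_inj; rewrite -fy.
  by exists (y :: p); rewrite /= exy ep lp sp.
have le_d : gdist e u v <= f u v by rewrite -sp -lp gdist_leq_path.
have [q [eq lq sq]] := gdist_path (leq_ltn_trans le_d lt_f).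
by apply/eqP; rewrite eqn_leq le_d -sq -lq f_path.
Qed.

Lemma edge_of u v : e u v -> exists A : edge e, val A = [set u; v].
Proof.
move=> euv; have A_in : [set u; v] \in edge_set e.
  by apply/imsetP; exists (u, v); rewrite ?inE.
by exists (exist (fun A => A \in edge_set e) _ A_in).
Qed.

Lemma edgeP (A : edge e) : exists u v, e u v /\ val A = [set u; v].
Proof.
by case: A => A /= /imsetP[[u v]]; rewrite inE /= => euv ->; exists u, v.
Qed.

Lemma gdist_edgeE w (A : edge e) u v :
  val A = [set u; v] -> gdist_edge w A = minn (gdist e w u) (gdist e w v).
Proof.
move=> defA; apply/eqP; rewrite eqn_leq leq_min /gdist_edge defA.
have le_min x : x \in [set u; v] ->
    \big[minn/#|T|]_(y in [set u; v]) gdist e w y <= gdist e w x.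
  move=> xuv; rewrite -minEnat -leEnat.
  exact: Order.TotalTheory.bigmin_le_cond.
rewrite !le_min ?set21 ?set22 //=.
elim/big_ind: _ => [|x y|x]; first by rewrite geq_min gdist_leq_card.
  by rewrite leq_min => -> ->.
by rewrite !inE => /orP[]/eqP->; rewrite geq_min leqnn ?orbT.
Qed.

Lemma mixed_resolving_leq S v : symmetric e -> mixed_resolving e S -> v \in S ->
  #|v |: [set u | e v u]| <= 2 ^ #|S|.-1.
Proof.
move=> sym_e resS vS.
pose P u := [set w in S :\ v | gdist e w u < gdist e w v].
have P_inj : {in v |: [set u | e v u] &, injective P}.
  (* The vertex [v] counts as a degenerate edge from [v] to itself, so that one distance formula
     serves all the elements. *)
  have elt u : u \in v |: [set u | e v u] -> exists x : element e,
      (match x with inl y => [set y] | inr A => val A end = [set v; u])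
      /\ forall w, gdist_element w x = minn (gdist e w v) (gdist e w u).
    rewrite !inE => /predU1P[->|evu].
      by exists (inl v); rewrite setUid; split=> // w; rewrite minnn.
    have [A defA] := edge_of evu; exists (inr A); split=> // w.
    exact: gdist_edgeE.
  have val_elt u w : u \in v |: [set u | e v u] -> w \in S :\ v ->
      minn (gdist e w v) (gdist e w u) = gdist e w v - (w \in P u).
    move=> Nu Sw; rewrite inE Sw /=; case: (ltnP (gdist e w u)) => [lt_uv|].
      have evu : e v u.
        by move: Nu lt_uv; rewrite !inE => /predU1P[->|//]; rewrite ltnn.
      by rewrite sym_e in evu; have := gdist_adj w evu; lia.
    by rewrite subn0 => /minn_idPl.
  move=> u u' Nu Nu' eqPu; apply/eqP; apply: contraT => neq_u.
  have [x [suppx dx]] := elt _ Nu; have [y [suppy dy]] := elt _ Nu'.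
  have neq_xy : x != y.
    apply: contraNneq neq_u => eq_xy.
    move: suppx; rewrite eq_xy suppy => /setP eq_s.
    have := eq_s u; have := eq_s u'; rewrite !inE !eqxx !orbT.
    case: eqP => [->|_] /=; last by rewrite eq_sym => /esym.
    by move=> _ /esym; rewrite orbb.
  have /existsP[w /andP[Sw]] := implyP (forallP (forallP resS x) y) neq_xy.
  rewrite /resolves dx dy; case: (eqVneq w v) => [->|neq_wv].
    by rewrite gdistxx !min0n.
  have Swv : w \in S :\ v by rewrite !inE neq_wv.
  by rewrite !val_elt // -eqPu eqxx.
rewrite -(card_in_imset P_inj) (cardsD1 v S) vS -card_powerset.
apply/subset_leq_card/subsetP => _ /imsetP[u _ ->]; rewrite inE.
by apply/subsetP=> w; rewrite inE => /andP[].
Qed.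

Lemma mixed_metric_dimE S k : mixed_resolving e S -> #|S| = k ->
  (forall S', mixed_resolving e S' -> k <= #|S'|) -> mixed_metric_dim e = k.
Proof.
move=> resS cardS leS; rewrite /mixed_metric_dim.
case: arg_minnP => [|S0 resS0 minS0]; last first.
  by apply/eqP; rewrite eqn_leq leS // -cardS minS0.
(* The default of [arg_min], the full vertex set, is mixed resolving because it contains [S]. *)
apply/forallP=> x; apply/forallP=> y; apply/implyP=> neq_xy.
have /existsP[w /andP[Sw res_w]] := implyP (forallP (forallP resS x) y) neq_xy.
by apply/existsP; exists w; rewrite inE.
Qed.

End Distance.

(** * The distance on a cycle *)

(** Subtraction is truncated, so [a - b + (b - a)] is the absolute difference, the length of one arc
    between [a] and [b]. *)
Definition cdist (m a b : nat) : nat :=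
  minn (a - b + (b - a)) (m - (a - b + (b - a))).

(** The minimum becomes linear constraints, split by the order of [a] and [b] and by which arc is
    shorter, in a form suited to [lia]. *)
Variant cdist_spec (m a b : nat) : nat -> Prop :=
| CdistLeNear t of a + t = b & t.*2 <= m : cdist_spec m a b t
| CdistGtNear t of b + t = a & t.*2 <= m & 0 < t : cdist_spec m a b t
| CdistLeFar t of b + t = a + m & t.*2 < m & 0 < t : cdist_spec m a b t
| CdistGtFar t of a + t = b + m & t.*2 < m & 0 < t : cdist_spec m a b t.

Lemma cdistP m a b : a < m -> b < m -> cdist_spec m a b (cdist m a b).
Proof.
rewrite /cdist => am bm; case: (leqP a b) => ab.
  rewrite (eqP ab) add0n; case: (leqP (b - a) (m - (b - a))) => h.
    by apply: CdistLeNear; lia.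
  by apply: CdistLeFar; lia.
rewrite (eqP (ltnW ab)) addn0; case: (leqP (a - b) (m - (a - b))) => h.
  by apply: CdistGtNear; lia.
by apply: CdistGtFar; lia.
Qed.

Ltac cdist_cases := repeat
  (match goal with |- context [cdist ?m ?a ?b] =>
    case: (@cdistP m a b); [lia | lia | move=> ? ? ? | move=> ? ? ? ?..] end;
  try (exfalso; lia)).


Section Cycle.
Variable m : nat.
Implicit Types i j k : 'I_m.

Lemma val_ordS i :
  i.+1 = m /\ ordS i = 0 :> nat \/ i.+1 < m /\ ordS i = i.+1 :> nat.
Proof.
have := ltn_ord i; rewrite leq_eqVlt /= => /predU1P[->|lt_i].
  by left; rewrite modnn.
by right; rewrite modn_small.
Qed.

Lemma cycle_graphE i j : cycle_graph i j = (j == ordS i) || (i == ordS j).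
Proof.
by rewrite /cycle_graph -!val_eqE /= !addn1 !(modn_small (ltn_ord _)).
Qed.

Lemma cdistxx i : cdist m i i = 0.
Proof. by rewrite /cdist subnn min0n. Qed.

Lemma cdist_eq0 i j : cdist m i j = 0 -> i = j.
Proof.
by case: (cdistP (ltn_ord i) (ltn_ord j)) => t ij *; apply: val_inj => /=; lia.
Qed.

Lemma cdist_adj i j k : cycle_graph i j -> cdist m i k <= (cdist m j k).+1.
Proof.
have := (ltn_ord i, ltn_ord j, ltn_ord k) => -[[im jm] km].
rewrite cycle_graphE => /orP[] /eqP/(congr1 (@nat_of_ord m)) ij.
  by case: (val_ordS i); rewrite -ij => -[? ?]; cdist_cases; lia.
by case: (val_ordS j); rewrite -ij => -[? ?]; cdist_cases; lia.
Qed.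

Lemma cdist_descent i k : 0 < cdist m i k ->
  exists2 j, cycle_graph i j & cdist m i k = (cdist m j k).+1.
Proof.
have im := ltn_ord i; have km := ltn_ord k => d0.
(* If a step forward does not approach [k], a step backward does. *)
have [dS|] := eqVneq (cdist m i k) (cdist m (ordS i) k).+1.
  by exists (ordS i); rewrite // cycle_graphE eqxx.
have := val_ordS (ord_pred i); rewrite ord_predK; have := ltn_ord (ord_pred i).
move=> pm ip dS; exists (ord_pred i).
  by rewrite cycle_graphE ord_predK eqxx orbT.
move: d0 dS; have sm := ltn_ord (ordS i).
by case: (val_ordS i) => -[? ?]; case: ip => -[? ?]; cdist_cases; lia.
Qed.

(** The midpoint of an edge is half a unit farther than the nearer end, even if both ends are
    equally far, as on the edge opposite to [k] in an odd cycle. *)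
Lemma cdist_edge i k :
  (minn (cdist m k i) (cdist m k (ordS i))).*2.+1 = cdist m.*2 k.*2 i.*2.+1.
Proof.
have im := ltn_ord i; have km := ltn_ord k.
have sm := ltn_ord (ordS i).
by case: (val_ordS i) => -[? ?]; cdist_cases; lia.
Qed.

Lemma cdist_lt i k : cdist m k i < m.
Proof.
have im := ltn_ord i; have km := ltn_ord k; cdist_cases; lia.
Qed.

Lemma cycle_graph_sym : symmetric (@cycle_graph m).
Proof. by move=> i j; rewrite /cycle_graph orbC. Qed.

Hypothesis hm : 2 < m.

Lemma ordS_neq i : ordS i != i.
Proof.
apply/eqP => /(congr1 (@nat_of_ord m)) h.
by case: (val_ordS i); rewrite h; lia.
Qed.

Lemma ord_pred_neq i : ord_pred i != i.
Proof. by rewrite -{2}[i]ord_predK eq_sym ordS_neq. Qed.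

(** Two steps forward do not close up on a cycle of length at least 3. This serves to give torus
    vertices four distinct neighbours. *)
Lemma ordS_pred_neq i : ordS i != ord_pred i.
Proof.
apply/eqP => /(congr1 (@ordS m)).
rewrite ord_predK => /(congr1 (@nat_of_ord m)).
by case: (val_ordS (ordS i)); case: (val_ordS i) => -[? ?] -[? ->]; lia.
Qed.

End Cycle.

(** * Locating points by landmarks, in doubled coordinates *)

Lemma cdist_double m a b : cdist m.*2 a.*2 b.*2 = (cdist m a b).*2.
Proof. rewrite /cdist -!doubleB -doubleD -doubleB; lia. Qed.

(* Here and below coordinates on the cycle are doubled, so that the odd numbers
   below m.*2 are the midpoints of the edges. *)
Lemma cdist_reflection m p x x' :
    m = p.*2 \/ m = p.*2.+1 -> 0 < p -> x < m.*2 -> x' < m.*2 ->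
    cdist m.*2 0.*2 x + cdist m.*2 p.*2 x'
      = cdist m.*2 0.*2 x' + cdist m.*2 p.*2 x ->
  x = x' \/ x + x' = m + p.*2.
Proof.
move=> hm p0 lx lx'.
by cdist_cases; lia.
Qed.

(** Moving both landmarks by 1 moves each doubled position by 2, so the reflection sum grows by 4;
    the third alternative is this sum reduced by [m.*2]. *)
Lemma cdist_reflection_shift m p x x' :
    m = p.*2 \/ m = p.*2.+1 -> 2 < m -> x < m.*2 -> x' < m.*2 ->
    cdist m.*2 1.*2 x + cdist m.*2 p.+1.*2 x'
      = cdist m.*2 1.*2 x' + cdist m.*2 p.+1.*2 x ->
  x = x' \/ x + x' = m + p.*2 + 4 \/ x + x' + m = p.*2 + 4.
Proof.
move=> hm p0 lx lx'.
by cdist_cases; lia.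
Qed.

(* A midpoint has a + b = 1; the distance to an edge is half a unit less than the
   distance to its midpoint, whence the correction terms a + b and a' + b'. *)
Lemma four_landmarks_inj m n p q i j a b i' j' a' b' :
  m = p.*2 \/ m = p.*2.+1 -> n = q.*2 \/ n = q.*2.+1 -> 2 < m -> 2 < n ->
  i < m -> i' < m -> j < n -> j' < n -> a + b <= 1 -> a' + b' <= 1 ->
  let D w v :=
    cdist m.*2 w.*2 (i.*2 + a) + cdist n.*2 v.*2 (j.*2 + b) + (a' + b')
    = cdist m.*2 w.*2 (i'.*2 + a') + cdist n.*2 v.*2 (j'.*2 + b') + (a + b) in
  D 0 0 -> D p 0 -> D p.+1 1 -> D p.+1 q.+1 ->
  [/\ i = i', j = j', a = a' & b = b'].
Proof.
move=> hm hn gm gn him him' hjn hjn' ha ha' D; rewrite {}/D => d1 d2 d3 d4.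
have ex : i.*2 + a = i'.*2 + a' \/ i.*2 + a + (i'.*2 + a') = m + p.*2.
  by apply: cdist_reflection => //; lia.
have ey := @cdist_reflection_shift n q (j.*2 + b) (j'.*2 + b') hn gn.
have {}ey : j.*2 + b = j'.*2 + b' \/ j.*2 + b + (j'.*2 + b') = n + q.*2 + 4
            \/ j.*2 + b + (j'.*2 + b') + n = q.*2 + 4 by apply: ey; lia.
suff: i.*2 + a = i'.*2 + a' /\ j.*2 + b = j'.*2 + b'.
  case=> {}ex {}ey; by clear -ex ey ha ha'; split; lia.
(* For even [m] and [n] the possible reflections are x to -x and y to 2 - y. The first preserves
   distances to 0, so [d1] excludes the second; then [d3] excludes the first, which does not
   preserve distances to p + 1. An odd length displaces the axis by a quarter step. *)
clear d2 d4; case: (i.*2 + a =P i'.*2 + a') ex => [ex _|nx [//|ex]].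
  split=> //; case: (j.*2 + b =P j'.*2 + b') ey => [//|ny [//|ey]].
  exfalso; move: d1 d3; rewrite ex.
  by case: ey => ey; cdist_cases; lia.
exfalso; case: ey => [ey|ey]; move: d1 d3.
  by rewrite -ey; cdist_cases; lia.
by case: ey => ey; cdist_cases; lia.
Qed.

(** * The torus: distances, lower bound and resolving set *)

Section Torus.
Variables m n : nat.
Let T := ('I_m * 'I_n)%type.
Let e : rel T := @torus_graph m n.
Implicit Types u v w : T.

Definition tdist u v := cdist m u.1 v.1 + cdist n u.2 v.2.

Lemma torus_gdist u v : gdist e u v = tdist u v.
Proof.
apply: (gdistE (f := tdist)) => [[i j] [k l]|x|[i j] [i' j'] [k l]|[i j] [k l]|].
- case/eqP; rewrite addn_eq0.
  by case/andP=> /eqP/cdist_eq0 /= -> /eqP/cdist_eq0 /= ->.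
- by rewrite /tdist !cdistxx.
- rewrite /e /torus_graph /cartesian_product /tdist /=.
  case/orP=> /andP[].
    by move=> /(cdist_adj k) ? /eqP->; rewrite -addSn leq_add2r.
  by move=> /eqP-> /(cdist_adj l) ?; rewrite -addnS leq_add2l.
- rewrite /e /torus_graph /cartesian_product /tdist /= addn_gt0 => /orP[].
    case/cdist_descent=> i' ii' ->; exists (i', j) => //=.
    by rewrite ii' eqxx.
  case/cdist_descent=> j' jj' ->; exists (i, j') => /=.
    by rewrite jj' eqxx orbT.
  by rewrite addnS.
(* The search range suffices because (m - 1) + (n - 1) < m n. *)
rewrite card_prod !card_ord /tdist.
have := cdist_lt v.1 u.1; have := cdist_lt v.2 u.2; nia.
Qed.

Lemma torus_sym : symmetric e.
Proof.
move=> u v; rewrite /e /torus_graph /cartesian_product.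
by rewrite (cycle_graph_sym u.1) (cycle_graph_sym u.2) (eq_sym u.1) (eq_sym u.2).
Qed.

Lemma torus_edgeP (A : edge e) : exists i j,
  val A = [set (i, j); (ordS i, j)] \/ val A = [set (i, j); (i, ordS j)].
Proof.
have [[i j] [[k l] [ekl ->]]] := edgeP A.
move: ekl; rewrite /e /torus_graph /cartesian_product /= !cycle_graphE.
case/orP=> /andP[].
  by case/orP=> /eqP-> /eqP->; [exists i, l | exists k, l; rewrite setUC]; left.
by move=> /eqP-> /orP[]/eqP->; [exists k, j | exists k, l; rewrite setUC]; right.
Qed.

(* x is the vertex, or the edge whose midpoint is, (i + a / 2, j + b / 2). *)
Definition at_point (x : element e) (i : 'I_m) (j : 'I_n) (a b : nat) :=
  match x with
  | inl v => v = (i, j) /\ a + b = 0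
  | inr A => val A = [set (i, j); (iter a (@ordS m) i, iter b (@ordS n) j)]
             /\ a + b = 1
  end.

Lemma at_point_ex x : exists i j a b, at_point x i j a b.
Proof.
case: x => [[i j]|A]; first by exists i, j, 0, 0.
have [i [j [defA|defA]]] := torus_edgeP A.
  by exists i, j, 1, 0.
by exists i, j, 0, 1.
Qed.

Lemma at_point_inj x y i j a b :
  at_point x i j a b -> at_point y i j a b -> x = y.
Proof.
case: x y => [v|A] [v'|A'] /=.
- by case=> -> _ [-> _].
- by case=> _ -> [].
- by case=> _ -> [].
by case=> defA _ [defA' _]; congr inr; apply: val_inj; rewrite /= defA defA'.
Qed.

Lemma at_point_leq x i j a b : at_point x i j a b -> a + b <= 1.
Proof. by case: x => [v|A] [_ ->]. Qed.

Lemma at_point_gdist x i j a b w : at_point x i j a b ->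
  (gdist_element w x).*2 + (a + b)
  = cdist m.*2 w.1.*2 (i.*2 + a) + cdist n.*2 w.2.*2 (j.*2 + b).
Proof.
case: x => [v|A] /= [].
  move=> -> /eqP; rewrite addn_eq0 => /andP[/eqP-> /eqP->].
  by rewrite !addn0 !cdist_double -doubleD torus_gdist.
move=> defA ab; rewrite (gdist_edgeE w defA) !torus_gdist /tdist /=.
(* Only the coordinate along the edge varies, so the minimum over the ends passes to that
   summand. *)
case: a b ab {defA} => [|[|a]] [|[|b]] //= _; rewrite !addn0 !addn1 cdist_double.
  by rewrite -cdist_edge -addn_minr doubleD addnS.
by rewrite -cdist_edge -addn_minl doubleD addSn.
Qed.

Hypotheses (hm : 2 < m) (hn : 2 < n).

Lemma torus_resolving_card S : mixed_resolving e S -> 4 <= #|S|.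
Proof.
move=> resS.
have [v vS] : exists v, v \in S.
  have [i j] : T by split; [exists 0 | exists 0]; lia.
  have /existsP[w /andP[Sw _]] :
      [exists w in S, resolves w (inl (ordS i, j)) (inl (i, j) : element e)].
    apply: (implyP (forallP (forallP resS _) _)).
    by apply: contraNneq (ordS_neq hm i) => -[->].
  by exists w.
(* A vertex and its four neighbours give 5 <= 2 ^ (|S| - 1), which forces |S| - 1 > 2. *)
suff N5 : 5 <= #|v |: [set u | e v u]|.
  have := leq_trans N5 (mixed_resolving_leq torus_sym resS vS).
  by rewrite -[4]/(2 ^ 2) ltn_exp2l //; lia.
case: v {vS} => i j.
pose s : seq T :=
  [:: (i, j); (ordS i, j); (ord_pred i, j); (i, ordS j); (i, ord_pred j)].
have us : uniq s.
  rewrite /= !inE !xpair_eqE !eqxx !andbT /= ![i == _]eq_sym ![j == _]eq_sym.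
  by rewrite !(negPf (ordS_neq _ _)) ?(negPf (ord_pred_neq _ _))
    ?(negPf (ordS_pred_neq _ _)).
rewrite -(card_uniqP us : _ = 5); apply/subset_leq_card/subsetP => u.
rewrite !inE /e /torus_graph /cartesian_product !cycle_graphE.
do 4?[case/predU1P=> [->|]]; last move/eqP->;
  by rewrite /= ?ord_predK !eqxx ?orbT.
Qed.

Lemma torus_resolving_set : exists2 S, mixed_resolving e S & #|S| = 4.
Proof.
pose p := m./2; pose q := n./2.
have mp : m = p.*2 \/ m = p.*2.+1.
  by rewrite /p; lia.
have nq : n = q.*2 \/ n = q.*2.+1.
  by rewrite /q; lia.
have [m0 pm p1m] : [/\ 0 < m, p < m & p.+1 < m] by split; lia.
have [n0 n1 q1n] : [/\ 0 < n, 1 < n & q.+1 < n] by split; lia.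
pose s : seq T := [:: (Ordinal m0, Ordinal n0); (Ordinal pm, Ordinal n0);
  (Ordinal p1m, Ordinal n1); (Ordinal p1m, Ordinal q1n)].
have us : uniq s by rewrite /= !inE !xpair_eqE -!val_eqE /=; lia.
exists [set w in s]; last by rewrite cardsE (card_uniqP us).
apply/forallP=> x; apply/forallP=> y; apply/implyP; apply: contraNT.
rewrite negb_exists => /forallP sxy; apply/eqP.
have dxy w : w \in s -> gdist_element w x = gdist_element w y.
  by move=> ws; have := sxy w; rewrite inE ws negbK => /eqP.
have [i [j [a [b px]]]] := at_point_ex x.
have [i' [j' [a' [b' py]]]] := at_point_ex y.
(* Each side receives the correction of the other element, which avoids subtraction. *)
have D w : w \in s ->
    cdist m.*2 w.1.*2 (i.*2 + a) + cdist n.*2 w.2.*2 (j.*2 + b) + (a' + b')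
    = cdist m.*2 w.1.*2 (i'.*2 + a') + cdist n.*2 w.2.*2 (j'.*2 + b') + (a + b).
  move=> ws; rewrite -(at_point_gdist w px) -(at_point_gdist w py) dxy //; lia.
have [] := four_landmarks_inj mp nq hm hn
  (ltn_ord i) (ltn_ord i') (ltn_ord j) (ltn_ord j')
  (at_point_leq px) (at_point_leq py)
  (D (_, _) (_ : (Ordinal m0, Ordinal n0) \in s))
  (D (_, _) (_ : (Ordinal pm, Ordinal n0) \in s))
  (D (_, _) (_ : (Ordinal p1m, Ordinal n1) \in s))
  (D (_, _) (_ : (Ordinal p1m, Ordinal q1n) \in s));
  rewrite ?inE ?eqxx ?orbT //.
move=> /val_inj eqi /val_inj eqj eqa eqb; subst.
exact: at_point_inj px py.
Qed.

End Torus.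

Theorem theorem5 (m n : nat) (hm : 3 <= m) (hn : 3 <= n) :
  mixed_metric_dim (@torus_graph m n) = 4.
Proof.
have [S resS cardS] := torus_resolving_set hm hn.
by apply: mixed_metric_dimE resS cardS _ => S'; apply: torus_resolving_card.
Qed.
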